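(* Let $G_1$ be the connected and simply connected Lie group whose Lie algebra $\mathfrak{g}_1$ has a basis $\{x,y,z\}$ with $[x,y]=0$, $[z,x]=y$, $[z,y]=-x+2y$. Put $x_1=-x+y$, $x_2=-x+2y$, $x_3=z$ (so $[x_1,x_2]=0$, $[x_3,x_1]=x_1$, $[x_3,x_2]=x_1+x_2$) and $Q=\begin{bmatrix}-2&-1&0\\1&1&0\\0&0&1\end{bmatrix}$. Let $h$ be a left invariant Lorentzian metric on $G_1$ whose matrix with respect to $\{x,y,z\}$ is $[h]=Q^tMQ$ (equivalently, whose matrix with respect to $\{x_1,x_2,x_3\}$ is $M$). In each case below $\{y_1,y_2,y_3\}$ is an $h$-orthonormal basis of $\mathfrak{g}_1$, and the Ricci operator $\mathrm{Ric}$ of $h$ has the stated matrix with respect to it and the stated O'Neill type; throughout $\mu>0$ and $\nu>0$. (1) If $M=\begin{bmatrix}0&0&1\\0&\mu&0\\1&0&0\end{bmatrix}$, and $y_1=\frac1{\sqrt\mu}x_2$, $y_2=\frac1{\sqrt2}(x_1+x_3)$, $y_3=\frac1{\sqrt2}(x_1-x_3)$, then $[\mathrm{Ric}]_{\{y_i\}}=\mathrm{diag}\{0,0,0\}$, i.e. $h$ is flat (O'Neill type $\{11,1\}$). (2) If $M=\begin{bmatrix}\mu&0&0\\0&0&1\\0&1&0\end{bmatrix}$, and $y_1=\frac1{\sqrt\mu}x_1$, $y_2=\frac1{\sqrt2}(x_2+x_3)$, $y_3=\frac1{\sqrt2}(x_2-x_3)$, then $$[\mathrm{Ric}]_{\{y_i\}}=\begin{bmatrix}-\frac\mu2&\sqrt{\frac\mu2}&-\sqrt{\frac\mu2}\\\sqrt{\frac\mu2}&\frac\mu2&0\\\sqrt{\frac\mu2}&0&\frac\mu2\end{bmatrix}\quad(\text{O'Neill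 type }\{21\}).$$ (3) If $M=\begin{bmatrix}1&0&0\\0&-\nu&0\\0&0&\mu\end{bmatrix}$, and $y_1=x_1$, $y_2=\frac1{\sqrt\mu}x_3$, $y_3=\frac1{\sqrt\nu}x_2$, then $$[\mathrm{Ric}]_{\{y_i\}}=\begin{bmatrix}-\frac{4\nu+1}{2\mu\nu}&0&-\frac1{\mu\sqrt\nu}\\0&\frac{1-4\nu}{2\mu\nu}&0\\\frac1{\mu\sqrt\nu}&0&\frac{1-4\nu}{2\mu\nu}\end{bmatrix},$$ and $\mathrm{Ric}$ is of O'Neill type $\{11,1\}$, $\{1z\bar z\}$, $\{21\}$ when $1-4\nu>0$, $<0$, $=0$, respectively. (4) If $M=\begin{bmatrix}1&0&0\\0&\nu&0\\0&0&-\mu\end{bmatrix}$, and $y_1=x_1$, $y_2=\frac1{\sqrt\nu}x_2$, $y_3=\frac1{\sqrt\mu}x_3$, then $$[\mathrm{Ric}]_{\{y_i\}}=\begin{bmatrix}\frac{4\nu-1}{2\mu\nu}&\frac1{\mu\sqrt\nu}&0\\\frac1{\mu\sqrt\nu}&\frac{4\nu+1}{2\mu\nu}&0\\0&0&\frac{4\nu+1}{2\mu\nu}\end{bmatrix}\quad(\text{O'Neill type }\{11,1\}).$$ (5) If $M=\begin{bmatrix}-1&0&0\\0&\nu&0\\0&0&\mu\end{bmatrix}$, and $y_1=\frac1{\sqrt\nu}x_2$, $y_2=\frac1{\sqrt\mu}x_3$, $y_3=x_1$, then $$[\mathrm{Ric}]_{\{y_i\}}=\begin{bmatrix}\frac{1-4\nu}{2\mu\nu}&0&\frac1{\mu\sqrt\nu}\\0&\frac{1-4\nu}{2\mu\nu}&0\\-\frac1{\mu\sqrt\nu}&0&-\frac{4\nu+1}{2\mu\nu}\end{bmatrix},$$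 and $\mathrm{Ric}$ is of O'Neill type $\{11,1\}$, $\{1z\bar z\}$, $\{21\}$ when $1-4\nu>0$, $<0$, $=0$, respectively. (6) If $M=\begin{bmatrix}0&1&0\\1&0&0\\0&0&\mu\end{bmatrix}$, and $y_1=\frac1{\sqrt\mu}x_3$, $y_2=\frac1{\sqrt2}(x_1+x_2)$, $y_3=\frac1{\sqrt2}(x_1-x_2)$, then $$[\mathrm{Ric}]_{\{y_i\}}=\begin{bmatrix}-\frac2\mu&0&0\\0&-\frac3\mu&\frac1\mu\\0&-\frac1\mu&-\frac1\mu\end{bmatrix}\quad(\text{O'Neill type }\{21\}).$$ (7) If $M=\begin{bmatrix}0&-1&0\\-1&0&0\\0&0&\mu\end{bmatrix}$, and $y_1=\frac1{\sqrt\mu}x_3$, $y_2=\frac1{\sqrt2}(x_1-x_2)$, $y_3=\frac1{\sqrt2}(x_1+x_2)$, then $$[\mathrm{Ric}]_{\{y_i\}}=\begin{bmatrix}-\frac2\mu&0&0\\0&-\frac1\mu&-\frac1\mu\\0&\frac1\mu&-\frac3\mu\end{bmatrix}\quad(\text{O'Neill type }\{21\}).$$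
   Context: A left invariant Lorentzian metric $h$ on a connected three-dimensional Lie group $G$ is identified with a nondegenerate symmetric bilinear form of signature $(+,+,-)$ on its Lie algebra $\mathfrak{g}$; its matrix $[h]$ in a basis of $\mathfrak{g}$ satisfies $h(u,v)=[u]^t[h][v]$. A basis $\{y_1,y_2,y_3\}$ is $h$-orthonormal if $h(y_1,y_1)=h(y_2,y_2)=1$, $h(y_3,y_3)=-1$ and $h(y_i,y_j)=0$ for $i\ne j$. The Levi-Civita connection $\nabla:\mathfrak{g}\times\mathfrak{g}\to\mathfrak{g}$ is given by $2h(\nabla_uv,w)=h([u,v],w)+h([w,u],v)+h([w,v],u)$. The curvature is $R_{uv}=\nabla_{[u,v]}-(\nabla_u\nabla_v-\nabla_v\nabla_u)$, the Ricci curvature $\mathrm{ric}(u,v)$ is the trace of $w\mapsto R_{uw}v$, and the Ricci operator $\mathrm{Ric}:\mathfrak{g}\to\mathfrak{g}$ is defined by $h(\mathrm{Ric}(u),v)=\mathrm{ric}(u,v)$. The $j$-th column of $[\mathrm{Ric}]_{\{y_i\}}$ is the coordinate vector of $\mathrm{Ric}(y_j)$. O'Neill types of an $h$-self-adjoint operator $T$ (matrix columns are images of basis vectors): type $\{11,1\}$ if $T$ has a diagonal matrix in some $h$-orthonormal basis; type $\{1z\bar z\}$ if in some $h$-orthonormal basis its matrix is $\begin{bmatrix}a&0&0\\0&\alpha&\beta\\0&-\beta&\alpha\end{bmatrix}$ with $\beta\ne0$; type $\{21\}$ if in some basis $\{e,u,v\}$ whose only non-zero products are $h(e,e)=h(u,v)=1$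 its matrix is $\begin{bmatrix}a&0&0\\0&b&\epsilon\\0&0&b\end{bmatrix}$ with $\epsilon=\pm1$. *)

(* Defs.v *)
From HB Require Import structures.
From mathcomp Require Import all_boot all_order all_algebra.
From mathcomp Require Import ring boolp classical_sets reals.

Set Implicit Arguments.
Unset Strict Implicit.
Unset Printing Implicit Defensive.

Import Order.TTheory GRing.Theory Num.Theory.
Local Open Scope ring_scope.

Definition mx3 (T : nzRingType) (rows : seq (seq T)) : 'M[T]_3 :=
  \matrix_(i, j) (nth [::] rows i)`_j.

Section Bases.
Variables (R : realType) (L : vectType R).

(* Columns are the coordinates of the images, hence the transpose of the
   row-vector convention of vector.mxof. *)
Definition matrix_in (n : nat) (b : n.-tuple L) (f : L -> L) : 'M[R]_n :=
  \matrix_(i, j) coord b i (f b`_j).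

Definition lftrace (f : L -> L) : R := \tr (matrix_in (vbasis {:L}) f).

Definition gram (n : nat) (h : {symmetric L}) (b : n.-tuple L) : 'M[R]_n :=
  \matrix_(i, j) h b`_i b`_j.

Lemma lftraceE n (b : n.-tuple L) (f : {linear L -> L}) :
  basis_of fullv b -> lftrace f = \tr (matrix_in b f).
Proof.
move=> bB; rewrite /lftrace; set e := vbasis {:L}.
have eB : basis_of fullv e := vbasisP _.
pose P := \matrix_(i, j) coord e i b`_j : 'M[R]_(\dim {:L}, n).
pose P' := \matrix_(i, j) coord b i e`_j : 'M[R]_(n, \dim {:L}).
have coordD m m' (c : m.-tuple L) (c' : m'.-tuple L) i v :
    basis_of fullv c -> coord c' i v = \sum_(j < m) coord c' i c`_j * coord c j v.
  move=> cB; rewrite {1}(coord_basis cB (memvf v)) linear_sum /=.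
  by apply: eq_bigr => j _; rewrite linearZ /= mulrC.
have fD m m' (c : m.-tuple L) (c' : m'.-tuple L) i v :
    basis_of fullv c ->
    coord c' i (f v) = \sum_(j < m) coord c' i (f c`_j) * coord c j v.
  move=> cB; rewrite {1}(coord_basis cB (memvf v)) !linear_sum /=.
  by apply: eq_bigr => j _; rewrite !linearZ /= mulrC.
have PP' : P' *m P = 1%:M.
  apply/matrixP => i j; rewrite !mxE.
  under eq_bigr do rewrite !mxE.
  rewrite -(coordD _ _ e b i b`_j eB) coord_free ?(basis_free bB) //.
  by rewrite eq_sym.
have -> : matrix_in e f = P *m (matrix_in b f *m P').
  apply/matrixP => i j; rewrite !mxE (coordD _ _ b e i _ bB).
  apply: eq_bigr => k _; rewrite !mxE (fD _ _ b b k _ bB); congr (_ * _).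
  by apply: eq_bigr => l _; rewrite !mxE.
by rewrite mxtrace_mulC -mulmxA PP' mulmx1.
Qed.

End Bases.

Section LeftInvariantGeometry.
Variables (R : realType) (L : vectType R).
Implicit Types (br : {bilinear L -> L -> L}) (h : {symmetric L}).
Implicit Types (b : 3.-tuple L) (T : L -> L).

Definition is_lie_bracket br : Prop :=
  (forall u, br u u = 0) /\
  (forall u v w, br u (br v w) + br v (br w u) + br w (br u v) = 0).

Definition orthonormal_basis h b : Prop :=
  basis_of fullv b /\
  gram h b = mx3 [:: [:: 1; 0; 0]; [:: 0; 1; 0]; [:: 0; 0; -1]].

(* A basis with h(e, e) = h(u, v) = 1 and all other products zero. *)
Definition pseudo_orthonormal_basis h b : Prop :=
  basis_of fullv b /\
  gram h b = mx3 [:: [:: 1; 0; 0]; [:: 0; 0; 1]; [:: 0; 1; 0]].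

(* dim L = 3 and h has signature (+,+,-); nondegeneracy is implied. *)
Definition lorentzian h : Prop := exists b, orthonormal_basis h b.

(* The vector a with h a w = phi w for all w; it exists and is unique when h is
   Lorentzian and phi is linear (sharpE, lorentzian_inj below). *)
Definition sharp h (phi : L -> R) : L :=
  xget 0 [set a : L | forall w, h a w = phi w].

(* The Koszul formula; see levi_civitaE for the defining equation. *)
Definition levi_civita br h (u v : L) : L :=
  sharp h (fun w => 2^-1 * (h (br u v) w + h (br w u) v + h (br w v) u)).

Definition curvature br h (u v w : L) : L :=
  let nabla := levi_civita br h in
  nabla (br u v) w - (nabla u (nabla v w) - nabla v (nabla u w)).

Definition flat br h : Prop := forall u v w, curvature br h u v w = 0.

Definition ricci br h (u v : L) : R :=
  lftrace (fun w => curvature br h u w v).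

(* h (ricci_op br h u) v = ricci br h u v, see ricci_opE. *)
Definition ricci_op br h (u : L) : L := sharp h (ricci br h u).

Definition self_adjoint h T : Prop := forall u v, h (T u) v = h u (T v).

Definition oneill_11_1 h T : Prop :=
  self_adjoint h T /\
  exists b, orthonormal_basis h b /\ is_diag_mx (matrix_in b T).

Definition oneill_1zz h T : Prop :=
  self_adjoint h T /\
  exists b a al be,
    [/\ orthonormal_basis h b, be != 0 &
        matrix_in b T =
          mx3 [:: [:: a; 0; 0]; [:: 0; al; be]; [:: 0; - be; al]]].

Definition oneill_21 h T : Prop :=
  self_adjoint h T /\
  exists b a c eps,
    [/\ pseudo_orthonormal_basis h b, eps = 1 \/ eps = -1 &
        matrix_in b T =
          mx3 [:: [:: a; 0; 0]; [:: 0; c; eps]; [:: 0; 0; c]]].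

Lemma gramE h b M (i j : 'I_3) : gram h b = M -> h b`_i b`_j = M i j.
Proof. by move=> <-; rewrite mxE. Qed.

Lemma formPl h k u v w : h (k *: u + v) w = k * h u w + h v w.
Proof. by rewrite linearPl. Qed.

Lemma formPr h k u v w : h w (k *: u + v) = k * h w u + h w v.
Proof. by rewrite linearPr. Qed.

Lemma bracketPl br k u v w : br (k *: u + v) w = k *: br u w + br v w.
Proof. by rewrite linearPl. Qed.

Lemma bracketPr br k u v w : br w (k *: u + v) = k *: br w u + br w v.
Proof. by rewrite linearPr. Qed.

Lemma form_suml h (F : 'I_3 -> R) b w :
  h (\sum_i F i *: b`_i) w = \sum_i F i * h b`_i w.
Proof. by rewrite linear_sumlz; apply: eq_bigr => i _; rewrite linearZl_LR. Qed.

Lemma orthonormal_off h b (i j : 'I_3) :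
  orthonormal_basis h b -> i != j -> h b`_i b`_j = 0.
Proof.
case=> _ bG; rewrite (gramE i j bG) mxE.
by case: i j => [[|[|[|i]]] //= ?] [[|[|[|j]]] //= ?].
Qed.

Lemma orthonormal_sqr h b (i : 'I_3) :
  orthonormal_basis h b -> h b`_i b`_i * h b`_i b`_i = 1.
Proof.
case=> _ bG; rewrite (gramE i i bG) mxE.
by case: i => [[|[|[|i]]] //= ?]; rewrite ?mulrNN mulr1.
Qed.

Lemma lorentzian_inj h a a' :
  lorentzian h -> (forall w, h a w = h a' w) -> a = a'.
Proof.
case=> b bO eqh; have [bB _] := bO.
have C c (i : 'I_3) : h c b`_i = coord b i c * h b`_i b`_i.
  rewrite {1}(coord_basis bB (memvf c)) form_suml (bigD1 i) //=.
  by rewrite big1 ?addr0 // => j ji; rewrite orthonormal_off ?mulr0.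
rewrite (coord_basis bB (memvf a)) (coord_basis bB (memvf a')).
apply: eq_bigr => i _; congr (_ *: _).
by rewrite -[LHS]mulr1 -[RHS]mulr1 -(orthonormal_sqr i bO) !mulrA -!C eqh.
Qed.

Lemma sharpE h (phi : L -> R) w :
  lorentzian h -> linear_for *%R phi -> h (sharp h phi) w = phi w.
Proof.
move=> [b bO] phiL; have [bB _] := bO; rewrite /sharp; move: w.
have phi0 : phi 0 = 0.
  by have := phiL (-1) 0 0; rewrite scaler0 addr0 mulN1r addNr.
have phiS F : phi (\sum_(i < 3) F i *: b`_i) = \sum_i F i * phi b`_i.
  apply: (big_rec2 (fun u r => phi u = r)) => // i r u _ <-.
  exact: phiL.
apply: (@xgetPex _ 0 [set a : L | forall w, h a w = phi w]%classic).
exists (\sum_(i < 3) (phi b`_i * h b`_i b`_i) *: b`_i) => /= w.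
rewrite form_suml {2}(coord_basis bB (memvf w)) phiS.
apply: eq_bigr => i _; rewrite [X in h _ X](coord_basis bB (memvf w)).
rewrite linear_sumr (bigD1 i) //= big1 => [|j ji]; last first.
  by rewrite linearZr_LR /= orthonormal_off ?mulr0 // eq_sym.
by rewrite addr0 linearZr_LR /= mulrACA orthonormal_sqr // mulr1 mulrC.
Qed.

Lemma levi_civitaE br h u v w : lorentzian h ->
  2 * h (levi_civita br h u v) w =
    h (br u v) w + h (br w u) v + h (br w v) u.
Proof.
move=> hL; rewrite sharpE //; first by rewrite mulVKf // pnatr_eq0.
by move=> k s t /=; rewrite !bracketPl !formPl !formPr; ring.
Qed.

Lemma levi_civitaPl br h k u v w : lorentzian h ->
  levi_civita br h (k *: u + v) w =
  k *: levi_civita br h u w + levi_civita br h v w.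
Proof.
move=> hL; apply: (lorentzian_inj hL) => t.
apply: (@mulfI _ 2); first by rewrite pnatr_eq0.
rewrite formPl mulrDr mulrCA !levi_civitaE // bracketPl bracketPr.
by rewrite !formPl !formPr; ring.
Qed.

Lemma levi_civitaPr br h k u v w : lorentzian h ->
  levi_civita br h w (k *: u + v) =
  k *: levi_civita br h w u + levi_civita br h w v.
Proof.
move=> hL; apply: (lorentzian_inj hL) => t.
apply: (@mulfI _ 2); first by rewrite pnatr_eq0.
rewrite formPl mulrDr mulrCA !levi_civitaE // !bracketPr.
by rewrite !formPl !formPr; ring.
Qed.

Lemma curvaturePr br h k u v w t : lorentzian h ->
  curvature br h u v (k *: w + t) =
  k *: curvature br h u v w + curvature br h u v t.
Proof.
move=> hL; rewrite /curvature !levi_civitaPr //.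
rewrite !scalerBr !opprD !opprK !addrA.
by rewrite [LHS](AC 6 (1*3*5*2*4*6)).
Qed.

Lemma ricci_opE br h u v :
  lorentzian h -> h (ricci_op br h u) v = ricci br h u v.
Proof.
move=> hL; rewrite sharpE // => k s t.
rewrite /ricci /lftrace /mxtrace mulr_sumr -big_split /=.
by apply: eq_bigr => i _; rewrite !mxE curvaturePr // linearP.
Qed.

End LeftInvariantGeometry.

(* Main.v *)
(* In the frame (x1, x2, x3) the Levi-Civita connection is the only torsion-free
   metric one, so it suffices to exhibit three matrices N_i (of nabla_(x_i))
   with M N_i skew and N_i e_j - N_j e_i = [x_i, x_j]; curvature and Ricci
   operator are then matrix polynomials in the N_i.  The seven metrics fall into
   four families of M, and every stated matrix follows by a change of frame S,
   i.e. from S^T M S = diag(1, 1, -1) and T S = S A.  In cases (3)-(7) the Ricci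
   operator preserves a line and its orthogonal plane, and the type is decided by
   the sign of the discriminant of the block on that plane. *)
Require Import Defs.
From HB Require Import structures.
From mathcomp Require Import all_boot all_order all_algebra.
From mathcomp Require Import reals ring lra.

Set Implicit Arguments.
Unset Strict Implicit.
Unset Printing Implicit Defensive.

Import Order.TTheory GRing.Theory Num.Theory.
Local Open Scope ring_scope.

(** * Frames and matrices of endomorphisms *)

Section Frames.
Variables (R : realType) (L : vectType R) (n : nat) (X : n.-tuple L).
Implicit Types (P A : 'M[R]_n) (h : {symmetric L}).

(** The columns of [P] are coordinates in [X], so a change of frame acts on Gram matrices by
    congruence and on endomorphisms by conjugation. *)
Definition frame P : n.-tuple L := [tuple \sum_i P i j *: X`_i | j < n].

Lemma nth_frame P (j : 'I_n) : (frame P)`_j = \sum_i P i j *: X`_i.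
Proof. by rewrite -tnth_nth tnth_mktuple. Qed.

Lemma gram_frame h P : gram h (frame P) = P^T *m gram h X *m P.
Proof.
apply/matrixP => i j; rewrite !mxE !nth_frame linear_sumr /=.
apply: eq_bigr => k _; rewrite linearZr_LR linear_sumlz /= mulrC !mxE.
congr (_ * _); apply: eq_bigr => l _.
by rewrite linearZl_LR !mxE.
Qed.

Hypothesis XB : basis_of fullv X.

Lemma coord_basis_nth (i j : 'I_n) : coord X i X`_j = (i == j)%:R.
Proof. by rewrite coord_free ?(basis_free XB) // eq_sym. Qed.

Lemma coord_comb (F : 'I_n -> R) i : coord X i (\sum_j F j *: X`_j) = F i.
Proof.
rewrite linear_sum (bigD1 i) //= linearZ /= coord_basis_nth eqxx mulr1.
by rewrite big1 ?addr0 // => j ji; rewrite linearZ /= coord_basis_nth eq_sym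
  (negPf ji) mulr0.
Qed.

Lemma basis_ext (u v : L) : (forall i, coord X i u = coord X i v) -> u = v.
Proof.
move=> uv; rewrite (coord_basis XB (memvf u)) (coord_basis XB (memvf v)).
by apply: eq_bigr => i _; rewrite uv.
Qed.

(** The columns of [invmx P] write each vector of [X] through the frame, so the frame spans; its
    length is the dimension. *)
Lemma frame_basis P : P \in unitmx -> basis_of fullv (frame P).
Proof.
move=> Pu; have dimL : \dim {:L} = n by rewrite -(size_basis XB).
rewrite basisEdim dimL size_tuple leqnn andbT.
apply/subvP => v _; rewrite (coord_basis XB (memvf v)).
apply: rpred_sum => i _; apply: rpredZ.
have -> : X`_i = \sum_(k < n) invmx P k i *: (frame P)`_k.
  under eq_bigr do rewrite nth_frame scaler_sumr.
  rewrite exchange_big /= (bigD1 i) //= [X in _ + X]big1 ?addr0 => [|l li].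
    under eq_bigr do rewrite scalerA mulrC.
    rewrite -scaler_suml; have /matrixP/(_ i i) := mulmxV Pu.
    by rewrite !mxE eqxx => ->; rewrite scale1r.
  under eq_bigr do rewrite scalerA mulrC.
  rewrite -scaler_suml; have /matrixP/(_ l i) := mulmxV Pu.
  by rewrite !mxE (negPf li) => ->; rewrite scale0r.
apply: rpred_sum => k _; apply/rpredZ/memv_span/mem_nth.
by rewrite size_tuple.
Qed.

Lemma matrix_inE (f : L -> L) A :
  (forall j : 'I_n, f X`_j = \sum_i A i j *: X`_i) <-> matrix_in X f = A.
Proof.
split=> [fA|<- j].
  by apply/matrixP => i j; rewrite mxE fA coord_comb.
rewrite (coord_basis XB (memvf (f _))).
by apply: eq_bigr => i _; rewrite mxE.
Qed.

(** Stated for a bare function: the connection, the curvature and the Ricci operator come with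
    linearity proofs, not as bundled linear maps. *)
Lemma linear_comb (f : L -> L) (F : 'I_n -> R) (b : n.-tuple L) : linear f ->
  f (\sum_j F j *: b`_j) = \sum_j F j *: f b`_j.
Proof.
move=> fL; have f0 : f 0 = 0.
  by have := fL (-1) 0 0; rewrite scaler0 addr0 scaleN1r addNr.
apply: (big_rec2 (fun u v => f u = v)) => // i u v _ <-; exact: fL.
Qed.

Lemma matrix_in_comp (f g : L -> L) : linear f ->
  matrix_in X (f \o g) = matrix_in X f *m matrix_in X g.
Proof.
move=> fL; apply/matrixP => i j; rewrite !mxE /=.
rewrite {1}(coord_basis XB (memvf (g _))) linear_comb // linear_sum /=.
by apply: eq_bigr => k _; rewrite linearZ /= !mxE mulrC.
Qed.

Lemma matrix_in_eq0 (f : L -> L) : linear f -> matrix_in X f = 0 ->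
  forall u, f u = 0.
Proof.
move=> fL /matrix_inE f0 u; rewrite (coord_basis XB (memvf u)) linear_comb //.
rewrite big1 // => j _; rewrite f0 big1 ?scaler0 // => i _.
by rewrite mxE scale0r.
Qed.

End Frames.

(** Conjugation in intertwining form, which spares the computation of [invmx P]. *)
Lemma matrix_in_frame (R : realType) (L : vectType R) n (X : n.-tuple L)
    (f : L -> L) (P A : 'M[R]_n) :
  basis_of fullv X -> linear f -> P \in unitmx ->
  matrix_in X f *m P = P *m A -> matrix_in (frame X P) f = A.
Proof.
move=> XB fL Pu fPA; apply/(matrix_inE (frame_basis XB Pu)) => j.
apply: (basis_ext XB) => l; rewrite nth_frame linear_comb //.
transitivity ((matrix_in X f *m P) l j).
  rewrite linear_sum !mxE; apply: eq_bigr => k _.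
  by rewrite linearZ /= mxE mulrC.
rewrite fPA mxE linear_sum; apply: eq_bigr => k _.
by rewrite linearZ /= nth_frame coord_comb // mulrC.
Qed.

(** * Connection, curvature and Ricci operator in a frame *)

Section Geometry.
Variables (R : realType) (L : vectType R).
Variables (br : {bilinear L -> L -> L}) (h : {symmetric L}).
Hypothesis hL : lorentzian h.
Variable X : 3.-tuple L.
Hypothesis XB : basis_of fullv X.

Let nabla := levi_civita br h.

Lemma form_sym u v : h u v = h v u.
Proof. by rewrite hermC expr0 mul1r. Qed.

Lemma form_basis_inj u v :
  (forall i : 'I_3, h u X`_i = h v X`_i) -> u = v.
Proof.
move=> uv; apply: (lorentzian_inj hL) => w.
rewrite (coord_basis XB (memvf w)) !linear_sumr /=.
by apply: eq_bigr => i _; rewrite !linearZr_LR /= uv.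
Qed.

(** With [D i j] for nabla_(X_i) X_j, the torsion condition turns the Koszul formula into six terms
    in [D]; the metric condition at (i, j, k), (j, i, k) and (k, i, j) collapses them to 2 h(D i j,
    X_k). *)
Lemma levi_civita_basis (D : 'I_3 -> 'I_3 -> L) :
  (forall i j : 'I_3, br X`_i X`_j = D i j - D j i) ->
  (forall i j k : 'I_3, h (D i j) X`_k + h (D i k) X`_j = 0) ->
  forall i j : 'I_3, nabla X`_i X`_j = D i j.
Proof.
move=> tor met i j; apply: form_basis_inj => k.
apply: (@mulfI _ 2); first by rewrite pnatr_eq0.
rewrite /nabla levi_civitaE // !tor !linearBl /=.
have m1 := met i j k; have m2 := met j i k; have m3 := met k i j.
by lra.
Qed.

Lemma linear_levi_civita u : linear (nabla u).
Proof. by move=> k v w; exact: levi_civitaPr. Qed.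

Lemma matrix_in_curvature u v :
  matrix_in X (curvature br h u v) =
  matrix_in X (nabla (br u v)) -
    (matrix_in X (nabla u) *m matrix_in X (nabla v) -
     matrix_in X (nabla v) *m matrix_in X (nabla u)).
Proof.
rewrite -!matrix_in_comp //; try exact: linear_levi_civita.
by apply/matrixP => i j; rewrite !mxE /curvature !linearB.
Qed.

Lemma linear_curvature u v : linear (curvature br h u v).
Proof. by move=> k w t; exact: curvaturePr. Qed.

Lemma curvaturePm k u v w t :
  curvature br h u (k *: v + w) t =
  k *: curvature br h u v t + curvature br h u w t.
Proof.
rewrite /curvature linearPr /= !levi_civitaPl // !levi_civitaPr //.
rewrite !scalerBr !opprD !opprK !addrA.
by rewrite [LHS](AC 6 (1*3*5*2*4*6)).
Qed.

Lemma curvaturePl k u v w t :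
  curvature br h (k *: u + v) w t =
  k *: curvature br h u w t + curvature br h v w t.
Proof.
rewrite /curvature linearPl /= !levi_civitaPl // !levi_civitaPr //.
rewrite !scalerBr !opprD !opprK !addrA.
by rewrite [LHS](AC 6 (1*3*5*2*4*6)).
Qed.

Lemma ricci_basis u (j : 'I_3) :
  ricci br h u X`_j = \sum_(k < 3) matrix_in X (curvature br h u X`_k) k j.
Proof.
have fL : linear (fun w => curvature br h u w X`_j).
  by move=> k v w; exact: curvaturePm.
(* [lftraceE], which moves the trace from [vbasis] to [X], takes a bundled linear map. *)
pose f := HB.pack_for {linear L -> L} (fun w => curvature br h u w X`_j)
  (GRing.isLinear.Build _ _ _ _ _ fL).
rewrite /ricci (lftraceE f XB) /mxtrace.
by apply: eq_bigr => k _; rewrite !mxE.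
Qed.

Lemma linear_ricci_op : linear (ricci_op br h).
Proof.
move=> k u v; apply: (lorentzian_inj hL) => w.
rewrite formPl !ricci_opE // /ricci /lftrace /mxtrace mulr_sumr -big_split.
by apply: eq_bigr => i _; rewrite !mxE curvaturePl linearP.
Qed.

(** Entry (i, j) of [gram h X *m T] is h(X_i, T X_j); lowering the index avoids inverting the Gram
    matrix. *)
Lemma matrix_in_ricci_op (T : 'M[R]_3) :
  (forall i j : 'I_3, (gram h X *m T) i j = ricci br h X`_j X`_i) ->
  matrix_in X (ricci_op br h) = T.
Proof.
move=> ricT; apply/(matrix_inE XB) => j; apply: form_basis_inj => i.
rewrite ricci_opE // -ricT form_suml mxE; apply: eq_bigr => k _.
by rewrite mxE mulrC form_sym.
Qed.

End Geometry.

(* If [B i] and [N i] are the matrices of [ad X_i] and [nabla_(X_i)] in a frame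
   [X], this is the matrix of the curvature operator of [X_i] and [X_j]. *)
Definition curvature_mx (R : realType) (B N : 'I_3 -> 'M[R]_3) (i j : 'I_3) :=
  \sum_k B i k j *: N k - (N i *m N j - N j *m N i).

(** * Curvature and Ricci operator computed from structure constants *)

Section StructureConstants.
Variables (R : realType) (L : vectType R).
Variables (br : {bilinear L -> L -> L}) (h : {symmetric L}) (X : 3.-tuple L).
Variables (B N : 'I_3 -> 'M[R]_3).
Hypothesis hL : lorentzian h.
Hypothesis XB : basis_of fullv X.
Hypothesis brB : forall i : 'I_3, matrix_in X (br X`_i) = B i.
Hypothesis N_torsion : forall i j k, N i k j - N j k i = B i k j.
Hypothesis N_metric :
  forall i, (gram h X *m N i)^T = - (gram h X *m N i).

(** [N i k j] plays the [k]-th coordinate of nabla_(X_i) X_j, and skewness of [gram h X *m N i] says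
    that this operator is skew-adjoint, so [levi_civita_basis] identifies it. *)
Lemma matrix_in_levi_civita (i : 'I_3) :
  matrix_in X (levi_civita br h X`_i) = N i.
Proof.
apply/(matrix_inE XB) => j.
apply: (levi_civita_basis hL XB (D := fun i j => \sum_k N i k j *: X`_k)).
  move=> {}i {}j; have /(matrix_inE XB) -> := brB i; rewrite -sumrB.
  by apply: eq_bigr => k _; rewrite -N_torsion scalerBl.
move=> {}i {}j k; rewrite !form_suml.
have /matrixP/(_ j k) := N_metric i; rewrite !mxE => e.
apply/eqP; rewrite addr_eq0; apply/eqP; apply: etrans (etrans e _).
  by apply: eq_bigr => l _; rewrite mxE mulrC form_sym.
by congr (- _); apply: eq_bigr => l _; rewrite mxE mulrC form_sym.
Qed.

(** The sum in [curvature_mx] is nabla along [X_i, X_j], with the bracket expanded in the frame. *)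
Lemma matrix_in_curvature_basis (i j : 'I_3) :
  matrix_in X (curvature br h X`_i X`_j) = curvature_mx B N i j.
Proof.
rewrite matrix_in_curvature // !matrix_in_levi_civita; congr (_ - _).
have /(matrix_inE XB) -> := brB i.
apply/matrixP => a b; rewrite !mxE summxE.
rewrite (@linear_comb _ _ _ (fun v => levi_civita br h v X`_b)); last first.
  by move=> k u v; exact: levi_civitaPl.
rewrite linear_sum; apply: eq_bigr => k _.
by rewrite linearZ /= mxE -matrix_in_levi_civita mxE.
Qed.

Lemma ricci_structure (i j : 'I_3) :
  ricci br h X`_i X`_j = \sum_k curvature_mx B N i k k j.
Proof.
rewrite ricci_basis //; apply: eq_bigr => k _.
by rewrite matrix_in_curvature_basis.
Qed.

Lemma ricci_op_structure (T : 'M[R]_3) :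
  (forall i j, (gram h X *m T) i j = \sum_k curvature_mx B N j k k i) ->
  matrix_in X (ricci_op br h) = T.
Proof.
by move=> e; apply: matrix_in_ricci_op => // i j; rewrite ricci_structure e.
Qed.

Lemma flat_structure :
  (forall i j, curvature_mx B N i j = 0) -> flat br h.
Proof.
move=> K0 u v w.
rewrite (coord_basis XB (memvf u)) (coord_basis XB (memvf v)).
rewrite (@linear_comb _ _ _ (fun u => curvature br h u _ w)); last first.
  by move=> k s t; exact: curvaturePl.
rewrite big1 // => i _.
rewrite (@linear_comb _ _ _ (fun v => curvature br h _ v w)); last first.
  by move=> k s t; exact: curvaturePm.
rewrite big1 ?scaler0 // => j _.
rewrite (matrix_in_eq0 XB (linear_curvature br hL _ _)) ?scaler0 //.
by rewrite matrix_in_curvature_basis.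
Qed.

End StructureConstants.

(** * Three by three matrices *)

(* In ['I_3] the indices are written [0], [1] and [-1], the last being 2. *)
Lemma forall3 (Q : 'I_3 -> Prop) : Q 0 -> Q 1 -> Q (-1) -> forall i, Q i.
Proof.
move=> Q0 Q1 Q2 [[|[|[|i]]] // ?];
  [move: Q0 | move: Q1 | move: Q2]; congr Q; exact: val_inj.
Qed.

Section ThreeByThree.
Variable R : nzRingType.
Implicit Types A : 'M[R]_3.

Lemma mx3P A A' :
  A 0 0 = A' 0 0 -> A 0 1 = A' 0 1 -> A 0 (-1) = A' 0 (-1) ->
  A 1 0 = A' 1 0 -> A 1 1 = A' 1 1 -> A 1 (-1) = A' 1 (-1) ->
  A (-1) 0 = A' (-1) 0 -> A (-1) 1 = A' (-1) 1 ->
  A (-1) (-1) = A' (-1) (-1) -> A = A'.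
Proof.
by move=> *; apply/matrixP; elim/forall3; elim/forall3.
Qed.

Lemma sum3 (V : nmodType) (F : 'I_3 -> V) : \sum_i F i = F 0 + F 1 + F (-1).
Proof.
rewrite !big_ord_recl big_ord0 addr0 addrA.
by congr (F _ + F _ + F _); exact: val_inj.
Qed.

Lemma mulmx3 (a b c d e f g h i a' b' c' d' e' f' g' h' i' : R) :
  mx3 [:: [:: a; b; c]; [:: d; e; f]; [:: g; h; i]] *m
  mx3 [:: [:: a'; b'; c']; [:: d'; e'; f']; [:: g'; h'; i']] =
  mx3 [:: [:: a * a' + b * d' + c * g'; a * b' + b * e' + c * h';
              a * c' + b * f' + c * i'];
          [:: d * a' + e * d' + f * g'; d * b' + e * e' + f * h';
              d * c' + e * f' + f * i'];
          [:: g * a' + h * d' + i * g'; g * b' + h * e' + i * h';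
              g * c' + h * f' + i * i']].
Proof. by apply: mx3P; rewrite !mxE sum3 !mxE. Qed.

Lemma trmx3 (a b c d e f g h i : R) :
  (mx3 [:: [:: a; b; c]; [:: d; e; f]; [:: g; h; i]])^T =
  mx3 [:: [:: a; d; g]; [:: b; e; h]; [:: c; f; i]].
Proof. by apply: mx3P; rewrite !mxE. Qed.

Lemma oppmx3 (a b c d e f g h i : R) :
  - mx3 [:: [:: a; b; c]; [:: d; e; f]; [:: g; h; i]] =
  mx3 [:: [:: - a; - b; - c]; [:: - d; - e; - f]; [:: - g; - h; - i]].
Proof. by apply: mx3P; rewrite !mxE. Qed.

Lemma addmx3 (a b c d e f g h i a' b' c' d' e' f' g' h' i' : R) :
  mx3 [:: [:: a; b; c]; [:: d; e; f]; [:: g; h; i]] +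
  mx3 [:: [:: a'; b'; c']; [:: d'; e'; f']; [:: g'; h'; i']] =
  mx3 [:: [:: a + a'; b + b'; c + c']; [:: d + d'; e + e'; f + f'];
          [:: g + g'; h + h'; i + i']].
Proof. by apply: mx3P; rewrite !mxE. Qed.

Lemma scalar_mx3 (a : R) :
  a%:M = mx3 [:: [:: a; 0; 0]; [:: 0; a; 0]; [:: 0; 0; a]].
Proof. by apply: mx3P; rewrite !mxE. Qed.

Lemma is_diag_mx3 (a b c : R) :
  is_diag_mx (mx3 [:: [:: a; 0; 0]; [:: 0; b; 0]; [:: 0; 0; c]]).
Proof.
by apply/is_diag_mxP; elim/forall3; elim/forall3 => //; rewrite mxE.
Qed.

Definition mx3E := (mulmx3, trmx3, oppmx3, addmx3).

End ThreeByThree.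

(** Splits an equation of explicit matrices into its entries; those that [ring] cannot close,
    typically because of division, are left to a following [field]. *)
Ltac mx3_ring :=
  congr (mx3 [:: [:: _; _; _]; [:: _; _; _]; [:: _; _; _]]); try by ring.

Lemma frame3 (R : realType) (L : vectType R) (u v w : L)
    (a b c d e f g h i : R) :
  frame [tuple u; v; w] (mx3 [:: [:: a; b; c]; [:: d; e; f]; [:: g; h; i]]) =
  [tuple a *: u + d *: v + g *: w; b *: u + e *: v + h *: w;
         c *: u + f *: v + i *: w].
Proof.
apply: eq_from_tnth => -[[|[|[|k]]] // ?];
  by rewrite tnth_mktuple sum3 !mxE (tnth_nth 0).
Qed.

(** * O'Neill types read off from a matrix *)

Section ONeillTypes.
Variables (R : realType) (L : vectType R) (h : {symmetric L}) (f : L -> L).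
Hypothesis fL : linear f.
Implicit Types (X Y : 3.-tuple L) (P A : 'M[R]_3).

(** Entry (i, j) of [gram h X *m matrix_in X f] is h(X_i, f X_j). *)
Lemma self_adjoint_mx X : basis_of fullv X ->
  (gram h X *m matrix_in X f)^T = gram h X *m matrix_in X f ->
  self_adjoint h f.
Proof.
move=> XB sym u v.
have hf (i j : 'I_3) : h X`_i (f X`_j) = (gram h X *m matrix_in X f) i j.
  have /(matrix_inE XB) -> := erefl (matrix_in X f).
  rewrite linear_sumr !mxE; apply: eq_bigr => k _.
  by rewrite linearZr_LR /= !mxE mulrC.
rewrite (coord_basis XB (memvf u)) (coord_basis XB (memvf v)).
rewrite !linear_comb // !linear_sumlz; apply: eq_bigr => i _.
rewrite !linear_sumr; apply: eq_bigr => j _.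
rewrite !(linearZr_LR, linearZl_LR) /= (form_sym h) !hf.
by rewrite -[in LHS]sym mxE.
Qed.

(** As [A] is an involution, [A *m (P^T *m gram h X)] is a left inverse of [P]. *)
Lemma gram_frame_unit X P A :
  A *m A = 1%:M -> gram h (frame X P) = A -> P \in unitmx.
Proof.
move=> AA; rewrite gram_frame => e.
have : (A *m (P^T *m gram h X)) *m P = 1%:M by rewrite -mulmxA e.
by case/mulmx1_unit.
Qed.

Lemma orthonormal_unit X P :
  gram h (frame X P) = mx3 [:: [:: 1; 0; 0]; [:: 0; 1; 0]; [:: 0; 0; -1]] ->
  P \in unitmx.
Proof.
apply: gram_frame_unit; rewrite scalar_mx3 !mx3E.
by mx3_ring.
Qed.

Lemma pseudo_orthonormal_unit X P :
  gram h (frame X P) = mx3 [:: [:: 1; 0; 0]; [:: 0; 0; 1]; [:: 0; 1; 0]] ->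
  P \in unitmx.
Proof.
apply: gram_frame_unit; rewrite scalar_mx3 !mx3E.
by mx3_ring.
Qed.

Lemma orthonormal_frame X P A :
  basis_of fullv X ->
  P^T *m gram h X *m P =
    mx3 [:: [:: 1; 0; 0]; [:: 0; 1; 0]; [:: 0; 0; -1]] ->
  matrix_in X f *m P = P *m A ->
  orthonormal_basis h (frame X P) /\ matrix_in (frame X P) f = A.
Proof.
rewrite -gram_frame => XB oP fP; have uP := orthonormal_unit oP.
by split; [split=> //; exact: frame_basis | exact: matrix_in_frame].
Qed.

Lemma pseudo_orthonormal_frame X P A :
  basis_of fullv X ->
  P^T *m gram h X *m P =
    mx3 [:: [:: 1; 0; 0]; [:: 0; 0; 1]; [:: 0; 1; 0]] ->
  matrix_in X f *m P = P *m A ->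
  pseudo_orthonormal_basis h (frame X P) /\ matrix_in (frame X P) f = A.
Proof.
rewrite -gram_frame => XB oP fP; have uP := pseudo_orthonormal_unit oP.
by split; [split=> //; exact: frame_basis | exact: matrix_in_frame].
Qed.


(** * Operators preserving a spacelike line and its orthogonal Lorentzian plane *)

Section LorentzianPlane.
Variables (a m d q : R) (Y : 3.-tuple L).
Hypothesis YO : orthonormal_basis h Y.
Hypothesis Yf : matrix_in Y f =
  mx3 [:: [:: a; 0; 0]; [:: 0; m + d; q]; [:: 0; - q; m - d]].

Let self_adjoint_f : self_adjoint h f.
Proof.
have [YB YG] := YO; apply: (self_adjoint_mx YB).
by rewrite YG Yf !mx3E; mx3_ring.
Qed.

(* The trace-free part of the block squares to the scalar [d ^+ 2 - q ^+ 2],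
   so [(d + l, - q)] is an eigenvector when [l ^+ 2 = d ^+ 2 - q ^+ 2]; the sign
   of [l] makes it spacelike. *)
Lemma oneill_11_1_block : 0 < d ^+ 2 - q ^+ 2 -> oneill_11_1 h f.
Proof.
have [YB YG] := YO => D2; split=> //.
have [l l2 lD] : exists2 l, l ^+ 2 = d ^+ 2 - q ^+ 2 & 0 < l * d.
  have s0 : 0 < Num.sqrt (d ^+ 2 - q ^+ 2) by rewrite sqrtr_gt0.
  have s2 := sqr_sqrtr (ltW D2).
  have [D0|D0|D0] := ltgtP d 0; last by move: D2; rewrite D0; nra.
    by exists (- Num.sqrt (d ^+ 2 - q ^+ 2)); [rewrite sqrrN | nra].
  by exists (Num.sqrt (d ^+ 2 - q ^+ 2)) => //; nra.
(* By [l2] this quantity equals 2 l (l + d). *)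
have k0 : 0 < (d + l) ^+ 2 - q ^+ 2 by nra.
have [n n0 n2] : exists2 n, n != 0 & n ^+ 2 = (d + l) ^+ 2 - q ^+ 2.
  exists (Num.sqrt ((d + l) ^+ 2 - q ^+ 2)); last exact/sqr_sqrtr/ltW.
  by rewrite gt_eqF ?sqrtr_gt0.
(* Columns 2 and 3 are the normalised eigenvectors for m + l (spacelike) and m - l (timelike). *)
pose P := mx3 [:: [:: 1; 0; 0]; [:: 0; (d + l) / n; - q / n];
                  [:: 0; - q / n; (d + l) / n]].
exists (frame Y P).
have [] := @orthonormal_frame Y P
  (mx3 [:: [:: a; 0; 0]; [:: 0; m + l; 0]; [:: 0; 0; m - l]]) YB.
- by rewrite YG !mx3E; mx3_ring; field: n2.
- by rewrite Yf !mx3E; mx3_ring; field: l2.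
move=> oP ->; split=> //.
exact: is_diag_mx3.
Qed.

(** Now the trace-free part N of the block squares to - b ^+ 2. For e = (q + b, - d) and f = (- d, q
    + b) one has N e = - b f and N f = b e; e and f are orthogonal with opposite norms, and the norm
    2 b (b + q) of e is positive when b has the sign of q. *)
Lemma oneill_1zz_block : d ^+ 2 - q ^+ 2 < 0 -> oneill_1zz h f.
Proof.
have [YB YG] := YO => D2; split=> //.
have D2' : 0 < q ^+ 2 - d ^+ 2 by lra.
have [b b2 bq] : exists2 b, b ^+ 2 = q ^+ 2 - d ^+ 2 & 0 < b * q.
  have s0 : 0 < Num.sqrt (q ^+ 2 - d ^+ 2) by rewrite sqrtr_gt0.
  have s2 := sqr_sqrtr (ltW D2').
  have [q0|q0|q0] := ltgtP q 0; last by move: D2; rewrite q0; nra.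
    by exists (- Num.sqrt (q ^+ 2 - d ^+ 2)); [rewrite sqrrN | nra].
  by exists (Num.sqrt (q ^+ 2 - d ^+ 2)) => //; nra.
have b0 : b != 0 by apply: contraTneq bq => ->; rewrite mul0r ltxx.
have k0 : 0 < (q + b) ^+ 2 - d ^+ 2 by nra.
have [n n0 n2] : exists2 n, n != 0 & n ^+ 2 = (q + b) ^+ 2 - d ^+ 2.
  exists (Num.sqrt ((q + b) ^+ 2 - d ^+ 2)); last exact/sqr_sqrtr/ltW.
  by rewrite gt_eqF ?sqrtr_gt0.
pose P := mx3 [:: [:: 1; 0; 0]; [:: 0; (q + b) / n; - d / n];
                  [:: 0; - d / n; (q + b) / n]].
exists (frame Y P), a, m, b.
have [] := @orthonormal_frame Y P
  (mx3 [:: [:: a; 0; 0]; [:: 0; m; b]; [:: 0; - b; m]]) YB.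
- by rewrite YG !mx3E; mx3_ring; field: n2.
- by rewrite Yf !mx3E; mx3_ring; field: b2.
by move=> oP fP; split.
Qed.

(** Now q = k d with k = 1 or -1, and the trace-free part is nilpotent: it kills the null vector (1,
    - k) and sends (1, k) to 2 d (1, - k). Scaling this null pair by [c] and its inverse, with c ^+
    2 = |d|, makes their product 1 and reduces the off-diagonal entry to the sign of d. *)
Lemma oneill_21_block : d ^+ 2 - q ^+ 2 = 0 -> d != 0 -> oneill_21 h f.
Proof.
have [YB YG] := YO => D2 d0; split=> //.
pose c := Num.sqrt `|d|; pose k := q / d; pose eps := Num.sg d.
have c2 : c ^+ 2 = `|d| by rewrite sqr_sqrtr.
have c0 : c != 0 by rewrite gt_eqF ?sqrtr_gt0 ?normr_gt0.
have dE : d = eps * c ^+ 2 by rewrite c2 -numEsg.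
have qE : q = k * d by rewrite divfK.
have k2 : k ^+ 2 = 1.
  by apply: (mulIf (expf_neq0 2 d0)); rewrite -exprMn -qE; lra.
have eps1 : eps = 1 \/ eps = -1 by rewrite /eps; case: sgrP d0; auto.
pose P := mx3 [:: [:: 1; 0; 0]; [:: 0; c; (2 * c)^-1];
                  [:: 0; - (k * c); k / (2 * c)]].
exists (frame Y P), a, m, eps.
have [] := @pseudo_orthonormal_frame Y P
  (mx3 [:: [:: a; 0; 0]; [:: 0; m; eps]; [:: 0; 0; m]]) YB.
- by rewrite YG !mx3E; mx3_ring; field: k2.
- by rewrite Yf qE dE !mx3E; mx3_ring; field: k2.
by move=> oP fP; split.
Qed.

End LorentzianPlane.

(** The invariant plane is spacelike, so its block is symmetric, with eigenvalues m + l and m - l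
    where l ^+ 2 = d ^+ 2 + q ^+ 2; q != 0 keeps the eigenvector (d + l, q) nonzero. *)
Lemma oneill_11_1_plane (a m d q : R) (Y : 3.-tuple L) :
  orthonormal_basis h Y -> q != 0 ->
  matrix_in Y f =
    mx3 [:: [:: m + d; q; 0]; [:: q; m - d; 0]; [:: 0; 0; a]] ->
  oneill_11_1 h f.
Proof.
move=> [YB YG] q0 Yf; split.
  apply: (self_adjoint_mx YB).
  by rewrite YG Yf !mx3E; mx3_ring.
have q2 : 0 < q ^+ 2 by rewrite exprn_even_gt0.
pose l := Num.sqrt (d ^+ 2 + q ^+ 2).
have l2 : l ^+ 2 = d ^+ 2 + q ^+ 2 by rewrite sqr_sqrtr; nra.
have k0 : 0 < (d + l) ^+ 2 + q ^+ 2 by nra.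
have [n n0 n2] : exists2 n, n != 0 & n ^+ 2 = (d + l) ^+ 2 + q ^+ 2.
  exists (Num.sqrt ((d + l) ^+ 2 + q ^+ 2)); last exact/sqr_sqrtr/ltW.
  by rewrite gt_eqF ?sqrtr_gt0.
pose P := mx3 [:: [:: (d + l) / n; - q / n; 0];
                  [:: q / n; (d + l) / n; 0]; [:: 0; 0; 1]].
exists (frame Y P).
have [] := @orthonormal_frame Y P
  (mx3 [:: [:: m + l; 0; 0]; [:: 0; m - l; 0]; [:: 0; 0; a]]) YB.
- by rewrite YG !mx3E; mx3_ring; field: n2.
- by rewrite Yf !mx3E; mx3_ring; field: l2.
move=> oP ->; split=> //.
exact: is_diag_mx3.
Qed.

End ONeillTypes.

(** * The Ricci operators of the left invariant metrics on G1 *)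

(** Reduces by computation at each index; the default of [nth] is never reached. *)
Definition family3 (T : Type) (A A' A'' : T) (i : 'I_3) : T :=
  nth A [:: A; A'; A''] i.

(* The matrices of [ad x_i] in the frame with [[x1, x2] = 0], [[x3, x1] = x1]
   and [[x3, x2] = x1 + x2]. *)
Definition g1_ad (R : realType) : 'I_3 -> 'M[R]_3 :=
  family3 (mx3 [:: [:: 0; 0; -1]; [:: 0; 0; 0]; [:: 0; 0; 0]])
          (mx3 [:: [:: 0; 0; -1]; [:: 0; 0; -1]; [:: 0; 0; 0]])
          (mx3 [:: [:: 1; 1; 0]; [:: 0; 1; 0]; [:: 0; 0; 0]]).

Section RicciOfG1.
Variables (R : realType) (L : vectType R).
Variables (br : {bilinear L -> L -> L}) (h : {symmetric L}) (x1 x2 x3 : L).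
Let X := [tuple x1; x2; x3].
Let Ric := ricci_op br h.
Hypothesis br_alt : forall u, br u u = 0.
Hypothesis XB : basis_of fullv X.
Hypothesis br12 : br x1 x2 = 0.
Hypothesis br31 : br x3 x1 = x1.
Hypothesis br32 : br x3 x2 = x1 + x2.
Hypothesis hL : lorentzian h.

Lemma bracket_antisym u v : br u v = - br v u.
Proof.
apply/eqP; rewrite -addr_eq0; apply/eqP.
have := br_alt (u + v).
by rewrite linearDl !linearDr /= !br_alt add0r addr0.
Qed.

Lemma g1_adE (i : 'I_3) : matrix_in X (br X`_i) = g1_ad R i.
Proof.
apply/(matrix_inE XB); elim/forall3: i; elim/forall3;
  rewrite sum3 !mxE /= ?scale0r ?scale1r ?scaleN1r ?addr0 ?add0r ?br_alt //.
- by rewrite bracket_antisym br31.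
- by rewrite bracket_antisym br12 oppr0.
- by rewrite bracket_antisym br32 opprD.
Qed.

Section Connection.
Variables N1 N2 N3 : 'M[R]_3.
Let N := family3 N1 N2 N3.
(** The curvature operators of (x1, x2), (x3, x1) and (x3, x2). [K12] has no bracket term because
    [x1, x2] = 0. *)
Let K12 := N2 *m N1 - N1 *m N2.
Let K31 := N1 - (N3 *m N1 - N1 *m N3).
Let K32 := N1 + N2 - (N3 *m N2 - N2 *m N3).

Lemma g1_curvature_mx (i j : 'I_3) :
  curvature_mx (g1_ad R) N i j =
  family3 (family3 0 K12 (- K31)) (family3 (- K12) 0 (- K32))
          (family3 K31 K32 0) i j.
Proof.
rewrite /curvature_mx; elim/forall3: i; elim/forall3: j; rewrite sum3 !mxE /=
  ?scale0r ?scale1r ?scaleN1r ?addr0 ?add0r ?subrr ?oppr0 ?opprB //.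
- by rewrite addrC.
- by rewrite -opprD addrC.
- by rewrite /K31 opprB.
- by rewrite /K32 opprB.
Qed.

Hypothesis N_metric :
  [/\ (gram h X *m N1)^T = - (gram h X *m N1),
      (gram h X *m N2)^T = - (gram h X *m N2) &
      (gram h X *m N3)^T = - (gram h X *m N3)].
Hypothesis N_torsion : forall i j k, N i k j - N j k i = g1_ad R i k j.

Let N_metric' i : (gram h X *m N i)^T = - (gram h X *m N i).
Proof. by case: N_metric => m1 m2 m3; elim/forall3: i. Qed.

(** Column [j] on the right lists ric(x_j, x_i): the trace over k of the curvature of (x_j, x_k),
    with the zero term k = j dropped. *)
Lemma g1_ricci (T : 'M[R]_3) :
  gram h X *m T =
    \matrix_(i, j) family3 (K12 1 i - K31 (-1) i) (- K12 0 i - K32 (-1) i)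
                           (K31 0 i + K32 1 i) j ->
  matrix_in X Ric = T.
Proof.
move=> ricT; apply: (ricci_op_structure hL XB g1_adE N_torsion N_metric').
move=> i j; rewrite ricT mxE sum3 !g1_curvature_mx.
by elim/forall3: j; rewrite /= !mxE ?add0r ?addr0.
Qed.

Lemma g1_flat : K12 = 0 -> K31 = 0 -> K32 = 0 -> flat br h.
Proof.
move=> K12_0 K31_0 K32_0.
apply: (flat_structure hL XB g1_adE N_torsion N_metric') => i j.
rewrite g1_curvature_mx K12_0 K31_0 K32_0 oppr0.
by elim/forall3: i; elim/forall3: j.
Qed.

End Connection.

(** Serves the metrics (3), (4) and (5), which differ in the signs of [a], [b], [c]. *)
Lemma g1_ricci_diag (a b c : R) : a != 0 -> b != 0 -> c != 0 ->
  gram h X = mx3 [:: [:: a; 0; 0]; [:: 0; b; 0]; [:: 0; 0; c]] ->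
  matrix_in X Ric =
    mx3 [:: [:: - 2 / c + a / (2 * b * c); - c^-1; 0];
            [:: - a / (b * c); - 2 / c - a / (2 * b * c); 0];
            [:: 0; 0; - 2 / c - a / (2 * b * c)]].
Proof.
move=> a0 b0 c0 hM; have nz := (a0, b0, c0).
(* The entries come from the Koszul formula; as the Gram matrix is diagonal, the coordinate along
   x_k is the value on x_k divided by h(x_k, x_k). *)
apply: (g1_ricci
  (N1 := mx3 [:: [:: 0; 0; -1]; [:: 0; 0; - a / (2 * b)];
                 [:: a / c; a / (2 * c); 0]])
  (N2 := mx3 [:: [:: 0; 0; - 2^-1]; [:: 0; 0; -1]; [:: a / (2 * c); b / c; 0]])
  (N3 := mx3 [:: [:: 0; 2^-1; 0]; [:: - a / (2 * b); 0; 0]; [:: 0; 0; 0]])).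
- by rewrite hM !mx3E; split; mx3_ring; field; rewrite ?nz.
- by elim/forall3; elim/forall3; elim/forall3; rewrite !mxE /=; field;
    rewrite ?nz.
- by rewrite hM !mx3E; apply: mx3P; rewrite /family3 !mxE /=; field;
    rewrite ?nz.
Qed.

(** Serves (6) and (7), with [e] equal to 1 and -1. Here [ad x3] is self-adjoint on the ideal
    spanned by x1 and x2, so nabla_(x3), its skew part there, vanishes: hence the zero [N3]. *)
Lemma g1_ricci_null (e c : R) : e != 0 -> c != 0 ->
  gram h X = mx3 [:: [:: 0; e; 0]; [:: e; 0; 0]; [:: 0; 0; c]] ->
  matrix_in X Ric =
    mx3 [:: [:: - 2 / c; - 2 / c; 0]; [:: 0; - 2 / c; 0]; [:: 0; 0; - 2 / c]].
Proof.
move=> e0 c0 hM; have nz := (e0, c0).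
apply: (g1_ricci
  (N1 := mx3 [:: [:: 0; 0; -1]; [:: 0; 0; 0]; [:: 0; e / c; 0]])
  (N2 := mx3 [:: [:: 0; 0; -1]; [:: 0; 0; -1]; [:: e / c; e / c; 0]])
  (N3 := mx3 [:: [:: 0; 0; 0]; [:: 0; 0; 0]; [:: 0; 0; 0]])).
- by rewrite hM !mx3E; split; mx3_ring; field; rewrite ?nz.
- by elim/forall3; elim/forall3; elim/forall3; rewrite !mxE /=; field;
    rewrite ?nz.
- by rewrite hM !mx3E; apply: mx3P; rewrite /family3 !mxE /=; field;
    rewrite ?nz.
Qed.

(** The metric (2), degenerate on the ideal spanned by x1 and x2: there x2 is null and pairs with
    x3. *)
Lemma g1_ricci_null23 (m : R) :
  gram h X = mx3 [:: [:: m; 0; 0]; [:: 0; 0; 1]; [:: 0; 1; 0]] ->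
  matrix_in X Ric =
    mx3 [:: [:: - (m / 2); 0; 1]; [:: m; m / 2; 0]; [:: 0; 0; m / 2]].
Proof.
move=> hM.
apply: (g1_ricci
  (N1 := mx3 [:: [:: 0; 0; -1]; [:: m; m / 2; 0]; [:: 0; 0; - (m / 2)]])
  (N2 := mx3 [:: [:: 0; 0; - 2^-1]; [:: m / 2; 0; 0]; [:: 0; 0; 0]])
  (N3 := mx3 [:: [:: 0; 2^-1; 0]; [:: 0; 1; 0]; [:: - (m / 2); 0; -1]])).
- by rewrite hM !mx3E; split; mx3_ring; field.
- by elim/forall3; elim/forall3; elim/forall3; rewrite !mxE /=; field.
- by rewrite hM !mx3E; apply: mx3P; rewrite /family3 !mxE /=; field.
Qed.

(** The metric (1). As [N1] vanishes, flatness comes down to the commutator of [N3] and [N2] being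
    [N2], matching [x3, x2] = x1 + x2. *)
Lemma g1_flat_null13 (m : R) : m != 0 ->
  gram h X = mx3 [:: [:: 0; 0; 1]; [:: 0; m; 0]; [:: 1; 0; 0]] ->
  flat br h.
Proof.
move=> m0 hM.
apply: (g1_flat
  (N1 := mx3 [:: [:: 0; 0; 0]; [:: 0; 0; 0]; [:: 0; 0; 0]])
  (N2 := mx3 [:: [:: 0; m; 0]; [:: 0; 0; -1]; [:: 0; 0; 0]])
  (N3 := mx3 [:: [:: 1; 1; 0]; [:: 0; 0; - m^-1]; [:: 0; 0; -1]])).
- by rewrite hM !mx3E; split; mx3_ring; field.
- by elim/forall3; elim/forall3; elim/forall3; rewrite !mxE /=; field.
- by rewrite !mx3E; apply: mx3P; rewrite /family3 !mxE /=; field.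
- by rewrite !mx3E; apply: mx3P; rewrite /family3 !mxE /=; field.
- by rewrite !mx3E; apply: mx3P; rewrite /family3 !mxE /=; field.
Qed.

End RicciOfG1.

Lemma flat_ricci_op (R : realType) (L : vectType R)
    (br : {bilinear L -> L -> L}) (h : {symmetric L}) u :
  lorentzian h -> flat br h -> ricci_op br h u = 0.
Proof.
move=> hL br0; apply: (lorentzian_inj hL) => v.
rewrite ricci_opE // linear0l /ricci /lftrace /mxtrace big1 // => i _.
by rewrite mxE br0 linear0.
Qed.

(** Lets each parameter be replaced by a square, so that the entries become rational functions
    within reach of [field]. *)
Lemma sqrt_pos (R : realType) (a : R) : 0 < a ->
  exists s, [/\ 0 < s, a = s ^+ 2 & Num.sqrt a = s].
Proof.
move=> a0; exists (Num.sqrt a).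
by rewrite sqrtr_gt0 sqr_sqrtr ?ltW.
Qed.

Ltac frame_eq :=
  rewrite frame3 !(scalerDr, scalerN, scaleNr, scale1r, scale0r);
  rewrite !(addr0, add0r, oppr0).

Theorem theorem3p13 (R : realType) (L : vectType R)
    (br : {bilinear L -> L -> L}) (x y z : L)
    (br_lie : is_lie_bracket br)
    (xyz_basis : basis_of fullv [tuple x; y; z])
    (br_xy : br x y = 0)
    (br_zx : br z x = y)
    (br_zy : br z y = - x + 2 *: y) :
  let x1 := - x + y in
  let x2 := - x + 2 *: y in
  let x3 := z in
  let E := [tuple x; y; z] in
  let X := [tuple x1; x2; x3] in
  let Q := mx3 [:: [:: -2; -1; 0]; [:: 1; 1; 0]; [:: 0; 0; 1 : R]] in
  [/\ basis_of fullv X,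
      br x1 x2 = 0,
      br x3 x1 = x1 &
      br x3 x2 = x1 + x2] /\
  forall h : {symmetric L}, lorentzian h ->
  (forall M : 'M[R]_3, gram h E = Q^T *m M *m Q <-> gram h X = M) /\
  forall mu nu : R, 0 < mu -> 0 < nu ->
  let Ric := ricci_op br h in
  (* (1) *)
  (let M := mx3 [:: [:: 0; 0; 1]; [:: 0; mu; 0]; [:: 1; 0; 0]] in
   let Y := [tuple (Num.sqrt mu)^-1 *: x2;
                   (Num.sqrt 2)^-1 *: (x1 + x3);
                   (Num.sqrt 2)^-1 *: (x1 - x3)] in
   gram h E = Q^T *m M *m Q ->
   [/\ orthonormal_basis h Y,
       matrix_in Y Ric =
         mx3 [:: [:: 0; 0; 0]; [:: 0; 0; 0]; [:: 0; 0; 0]],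
       flat br h &
       oneill_11_1 h Ric]) /\
  (* (2) *)
  (let M := mx3 [:: [:: mu; 0; 0]; [:: 0; 0; 1]; [:: 0; 1; 0]] in
   let Y := [tuple (Num.sqrt mu)^-1 *: x1;
                   (Num.sqrt 2)^-1 *: (x2 + x3);
                   (Num.sqrt 2)^-1 *: (x2 - x3)] in
   gram h E = Q^T *m M *m Q ->
   [/\ orthonormal_basis h Y,
       matrix_in Y Ric =
         mx3 [:: [:: - (mu / 2); Num.sqrt (mu / 2); - Num.sqrt (mu / 2)];
                 [:: Num.sqrt (mu / 2); mu / 2; 0];
                 [:: Num.sqrt (mu / 2); 0; mu / 2]] &
       oneill_21 h Ric]) /\
  (* (3) *)
  (let M := mx3 [:: [:: 1; 0; 0]; [:: 0; - nu; 0]; [:: 0; 0; mu]] in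
   let Y := [tuple x1;
                   (Num.sqrt mu)^-1 *: x3;
                   (Num.sqrt nu)^-1 *: x2] in
   gram h E = Q^T *m M *m Q ->
   [/\ orthonormal_basis h Y,
       matrix_in Y Ric =
         mx3 [:: [:: - ((4 * nu + 1) / (2 * mu * nu)); 0;
                     - (1 / (mu * Num.sqrt nu))];
                 [:: 0; (1 - 4 * nu) / (2 * mu * nu); 0];
                 [:: 1 / (mu * Num.sqrt nu); 0;
                     (1 - 4 * nu) / (2 * mu * nu)]],
       0 < 1 - 4 * nu -> oneill_11_1 h Ric,
       1 - 4 * nu < 0 -> oneill_1zz h Ric &
       1 - 4 * nu = 0 -> oneill_21 h Ric]) /\
  (* (4) *)
  (let M := mx3 [:: [:: 1; 0; 0]; [:: 0; nu; 0]; [:: 0; 0; - mu]] in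
   let Y := [tuple x1;
                   (Num.sqrt nu)^-1 *: x2;
                   (Num.sqrt mu)^-1 *: x3] in
   gram h E = Q^T *m M *m Q ->
   [/\ orthonormal_basis h Y,
       matrix_in Y Ric =
         mx3 [:: [:: (4 * nu - 1) / (2 * mu * nu);
                     1 / (mu * Num.sqrt nu); 0];
                 [:: 1 / (mu * Num.sqrt nu);
                     (4 * nu + 1) / (2 * mu * nu); 0];
                 [:: 0; 0; (4 * nu + 1) / (2 * mu * nu)]] &
       oneill_11_1 h Ric]) /\
  (* (5) *)
  (let M := mx3 [:: [:: -1; 0; 0]; [:: 0; nu; 0]; [:: 0; 0; mu]] in
   let Y := [tuple (Num.sqrt nu)^-1 *: x2;
                   (Num.sqrt mu)^-1 *: x3;
                   x1] in
   gram h E = Q^T *m M *m Q ->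
   [/\ orthonormal_basis h Y,
       matrix_in Y Ric =
         mx3 [:: [:: (1 - 4 * nu) / (2 * mu * nu); 0;
                     1 / (mu * Num.sqrt nu)];
                 [:: 0; (1 - 4 * nu) / (2 * mu * nu); 0];
                 [:: - (1 / (mu * Num.sqrt nu)); 0;
                     - ((4 * nu + 1) / (2 * mu * nu))]],
       0 < 1 - 4 * nu -> oneill_11_1 h Ric,
       1 - 4 * nu < 0 -> oneill_1zz h Ric &
       1 - 4 * nu = 0 -> oneill_21 h Ric]) /\
  (* (6) *)
  (let M := mx3 [:: [:: 0; 1; 0]; [:: 1; 0; 0]; [:: 0; 0; mu]] in
   let Y := [tuple (Num.sqrt mu)^-1 *: x3;
                   (Num.sqrt 2)^-1 *: (x1 + x2);
                   (Num.sqrt 2)^-1 *: (x1 - x2)] in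
   gram h E = Q^T *m M *m Q ->
   [/\ orthonormal_basis h Y,
       matrix_in Y Ric =
         mx3 [:: [:: - (2 / mu); 0; 0];
                 [:: 0; - (3 / mu); 1 / mu];
                 [:: 0; - (1 / mu); - (1 / mu)]] &
       oneill_21 h Ric]) /\
  (* (7) *)
  (let M := mx3 [:: [:: 0; -1; 0]; [:: -1; 0; 0]; [:: 0; 0; mu]] in
   let Y := [tuple (Num.sqrt mu)^-1 *: x3;
                   (Num.sqrt 2)^-1 *: (x1 - x2);
                   (Num.sqrt 2)^-1 *: (x1 + x2)] in
   gram h E = Q^T *m M *m Q ->
   [/\ orthonormal_basis h Y,
       matrix_in Y Ric =
         mx3 [:: [:: - (2 / mu); 0; 0];
                 [:: 0; - (1 / mu); - (1 / mu)];
                 [:: 0; 1 / mu; - (3 / mu)]] &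
       oneill_21 h Ric]).
Proof.
move=> x1 x2 x3 E X Q; have [br_alt _] := br_lie.
(* The inverse of [Q]; its columns are the coordinates of x1, x2, x3 in (x, y, z). *)
pose P : 'M[R]_3 := mx3 [:: [:: -1; -1; 0]; [:: 1; 2; 0]; [:: 0; 0; 1]].
have QP : Q *m P = 1%:M by rewrite scalar_mx3 !mx3E; mx3_ring.
have [_ uP] := mulmx1_unit QP.
have XE : X = frame E P.
  by rewrite frame3 /X /x1 /x2 /x3 !scaleN1r !scale1r !scale0r !addr0 !add0r.
have XB : basis_of fullv X by rewrite XE; exact: frame_basis.
have br12 : br x1 x2 = 0.
  rewrite linearDl /= linearNl !linearDr /= !linearNr !linearZ /= !br_alt br_xy.
  by rewrite (bracket_antisym br_alt y x) br_xy !(oppr0, scaler0, addr0).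
have x21 : - y + x2 = x1 by rewrite /x2 scaler_nat mulr2n addrCA addKr.
have br31 : br x3 x1 = x1 by rewrite linearDr /= linearNr br_zx br_zy.
have br32 : br x3 x2 = x1 + x2.
  rewrite linearDr /= linearNr linearZ /= br_zx br_zy.
  by rewrite scaler_nat mulr2n addrA x21.
split=> // h hL; have hMX M : gram h E = Q^T *m M *m Q <-> gram h X = M.
  have PTQT : P^T *m Q^T = 1%:M by rewrite -trmx_mul QP trmx1.
  have QTPT : Q^T *m P^T = 1%:M by rewrite -trmx_mul (mulmx1C QP) trmx1.
  rewrite XE gram_frame; split=> [->|<-].
    by rewrite !mulmxA PTQT mul1mx -mulmxA QP mulmx1.
  by rewrite !mulmxA QTPT mul1mx -mulmxA (mulmx1C QP) mulmx1.
split=> // mu nu mu0 nu0 Ric.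
(* From here on only the basis property, the brackets and the Gram matrix of [X] matter. *)
clearbody x1 x2 x3.
have RicL : linear Ric := linear_ricci_op br hL.
(* From now on mu = s ^+ 2, nu = t ^+ 2 and 2 = r ^+ 2; [r2] is handed to [field] as a side
   equation. *)
have [s [s_gt0 mus ->]] := sqrt_pos mu0.
have [t [t_gt0 nut ->]] := sqrt_pos nu0.
have [r [r_gt0 /esym r2 ->]] := sqrt_pos (ltr0Sn R 1).
have [s0 t0 r0] : [/\ s != 0, t != 0 & r != 0] by rewrite !gt_eqF.
subst mu nu; have nz := (s0, t0, r0).
have [o0 no0] : (1 : R) != 0 /\ (-1 : R) != 0 by rewrite oppr_eq0 oner_neq0.
have [ss0 tt0] : s ^+ 2 != 0 /\ t ^+ 2 != 0 by rewrite !expf_neq0.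
have k0 : 0 < 2 * s ^+ 2 * t ^+ 2 by rewrite !(mulr_gt0, exprn_gt0).
have [ns0 nt0] : - s ^+ 2 != 0 /\ - t ^+ 2 != 0 by rewrite !oppr_eq0.
have frameX (Y : 3.-tuple L) (S A : 'M[R]_3) : Y = frame X S ->
    S^T *m gram h X *m S =
      mx3 [:: [:: 1; 0; 0]; [:: 0; 1; 0]; [:: 0; 0; -1]] ->
    matrix_in X Ric *m S = S *m A ->
    orthonormal_basis h Y /\ matrix_in Y Ric = A.
  by move=> ->; exact: orthonormal_frame.
split; [|split; [|split; [|split; [|split; [|split]]]]];
  move=> M Y; rewrite hMX => hM.
(* Flatness gives Ric = 0, which is diagonal in every orthonormal basis. *)
- have flat_h : flat br h.
    by apply: (g1_flat_null13 br_alt XB br12 br31 br32 hL) hM; rewrite gt_eqF.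
  have Ric0 u : Ric u = 0 by exact: flat_ricci_op.
  have [] := frameX Y
    (mx3 [:: [:: 0; r^-1; r^-1]; [:: s^-1; 0; 0]; [:: 0; r^-1; - r^-1]])
    (mx3 [:: [:: 0; 0; 0]; [:: 0; 0; 0]; [:: 0; 0; 0]]).
  + by rewrite /Y; frame_eq.
  + by rewrite hM /M !mx3E; mx3_ring; field: r2; rewrite ?nz.
  + have -> : matrix_in X Ric = 0.
      by apply/matrixP => i j; rewrite !mxE Ric0 linear0.
    by rewrite mul0mx !mx3E; apply: mx3P; rewrite !mxE /=; ring.
  move=> YO YRic; split=> //; split.
    by move=> u v; rewrite !Ric0 linear0l linear0r.
  by exists Y; rewrite YRic is_diag_mx3.
- have XRic := g1_ricci_null23 br_alt XB br12 br31 br32 hL hM.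
  have -> : Num.sqrt (s ^+ 2 / 2) = s / r.
    have -> : s ^+ 2 / 2 = (s / r) ^+ 2 by field: r2.
    by rewrite sqrtr_sqr gtr0_norm // divr_gt0.
  have [] := frameX Y
    (mx3 [:: [:: s^-1; 0; 0]; [:: 0; r^-1; r^-1]; [:: 0; r^-1; - r^-1]])
    (mx3 [:: [:: - (s ^+ 2 / 2); s / r; - (s / r)]; [:: s / r; s ^+ 2 / 2; 0];
             [:: s / r; 0; s ^+ 2 / 2]]).
  + by rewrite /Y; frame_eq.
  + by rewrite hM /M !mx3E; mx3_ring; field: r2; rewrite ?nz.
  + by rewrite XRic !mx3E; mx3_ring; field: r2; rewrite ?nz.
  move=> YO YRic; split=> //; split.
    apply: (self_adjoint_mx RicL XB).
    by rewrite hM XRic !mx3E; mx3_ring; field: r2; rewrite ?nz.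
  (* A unit eigenvector for - mu / 2, the null eigenvector x2 for mu / 2, and the null v with h(x2,
     v) = 1 and (Ric - mu / 2) v = x2. *)
  pose S := mx3 [:: [:: s^-1; 0; (s ^+ 2)^-1];
                    [:: - s^-1; 1; - (2 * s ^+ 2)^-1]; [:: 0; 0; 1]].
  have [] := @pseudo_orthonormal_frame _ _ h _ RicL X S
    (mx3 [:: [:: - (s ^+ 2 / 2); 0; 0]; [:: 0; s ^+ 2 / 2; 1];
             [:: 0; 0; s ^+ 2 / 2]]) XB.
  + by rewrite hM /M !mx3E; mx3_ring; field; rewrite ?nz.
  + by rewrite XRic !mx3E; mx3_ring; field; rewrite ?nz.
  by move=> SO SRic; exists (frame X S), (- (s ^+ 2 / 2)), (s ^+ 2 / 2), 1;
    split=> //; left.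
- have XRic := g1_ricci_diag br_alt XB br12 br31 br32 hL o0 nt0 ss0 hM.
  have [] := frameX Y
    (mx3 [:: [:: 1; 0; 0]; [:: 0; 0; t^-1]; [:: 0; s^-1; 0]])
    (mx3 [:: [:: - ((4 * t ^+ 2 + 1) / (2 * s ^+ 2 * t ^+ 2)); 0;
                 - (1 / (s ^+ 2 * t))];
             [:: 0; (1 - 4 * t ^+ 2) / (2 * s ^+ 2 * t ^+ 2); 0];
             [:: 1 / (s ^+ 2 * t); 0;
                 (1 - 4 * t ^+ 2) / (2 * s ^+ 2 * t ^+ 2)]]).
  + by rewrite /Y; frame_eq.
  + by rewrite hM /M !mx3E; mx3_ring; field; rewrite ?nz.
  + by rewrite XRic !mx3E; mx3_ring; field; rewrite ?nz.
  (* Half the difference of the diagonal entries and the off-diagonal entry of the block on the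
     plane of x1 and x2; the discriminant has the sign of 1 - 4 nu. *)
  pose d := - (2 * s ^+ 2 * t ^+ 2)^-1; pose q := - (s ^+ 2 * t)^-1.
  have disc : d ^+ 2 - q ^+ 2 = (1 - 4 * t ^+ 2) / (2 * s ^+ 2 * t ^+ 2) ^+ 2.
    by rewrite /d /q; field; rewrite ?nz.
  (* The same vectors as [Y], with the invariant spacelike line along x3 put first. *)
  pose S := mx3 [:: [:: 0; 1; 0]; [:: 0; 0; t^-1]; [:: s^-1; 0; 0]].
  have [] := frameX (frame X S) S
    (mx3 [:: [:: (1 - 4 * t ^+ 2) / (2 * s ^+ 2 * t ^+ 2); 0; 0];
             [:: 0; - (2 / s ^+ 2) + d; q];
             [:: 0; - q; - (2 / s ^+ 2) - d]]) erefl.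
  + by rewrite hM /M !mx3E; mx3_ring; field; rewrite ?nz.
  + by rewrite XRic !mx3E /d /q; mx3_ring; field; rewrite ?nz.
  move=> SO SRic YO YRic; split=> // sgn.
  + apply: (oneill_11_1_block RicL SO SRic).
    by rewrite disc divr_gt0 ?exprn_gt0.
  + apply: (oneill_1zz_block RicL SO SRic).
    by rewrite disc pmulr_llt0 ?invr_gt0 ?exprn_gt0.
  + apply: (oneill_21_block RicL SO SRic).
      by rewrite disc sgn mul0r.
    by rewrite oppr_eq0 invr_neq0 // gt_eqF.
- have XRic := g1_ricci_diag br_alt XB br12 br31 br32 hL o0 tt0 ns0 hM.
  have [] := frameX Y
    (mx3 [:: [:: 1; 0; 0]; [:: 0; t^-1; 0]; [:: 0; 0; s^-1]])
    (mx3 [:: [:: (4 * t ^+ 2 - 1) / (2 * s ^+ 2 * t ^+ 2);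
                 1 / (s ^+ 2 * t); 0];
             [:: 1 / (s ^+ 2 * t);
                 (4 * t ^+ 2 + 1) / (2 * s ^+ 2 * t ^+ 2); 0];
             [:: 0; 0; (4 * t ^+ 2 + 1) / (2 * s ^+ 2 * t ^+ 2)]]).
  + by rewrite /Y; frame_eq.
  + by rewrite hM /M !mx3E; mx3_ring; field; rewrite ?nz.
  + by rewrite XRic !mx3E; mx3_ring; field; rewrite ?nz.
  move=> YO YRic; split=> //.
  (* Here x3 is timelike, so the invariant plane of x1 and x2 is spacelike and [Y] already has the
     required block form. *)
  apply: (@oneill_11_1_plane _ _ h _ RicL
    ((4 * t ^+ 2 + 1) / (2 * s ^+ 2 * t ^+ 2)) (2 / s ^+ 2)
    (- (2 * s ^+ 2 * t ^+ 2)^-1) (1 / (s ^+ 2 * t)) Y YO).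
    by rewrite mul1r invr_neq0 // mulf_neq0.
  by rewrite YRic; mx3_ring; field; rewrite ?nz.
- have XRic := g1_ricci_diag br_alt XB br12 br31 br32 hL no0 tt0 ss0 hM.
  have [] := frameX Y
    (mx3 [:: [:: 0; 0; 1]; [:: t^-1; 0; 0]; [:: 0; s^-1; 0]])
    (mx3 [:: [:: (1 - 4 * t ^+ 2) / (2 * s ^+ 2 * t ^+ 2); 0;
                 1 / (s ^+ 2 * t)];
             [:: 0; (1 - 4 * t ^+ 2) / (2 * s ^+ 2 * t ^+ 2); 0];
             [:: - (1 / (s ^+ 2 * t)); 0;
                 - ((4 * t ^+ 2 + 1) / (2 * s ^+ 2 * t ^+ 2))]]).
  + by rewrite /Y; frame_eq.
  + by rewrite hM /M !mx3E; mx3_ring; field; rewrite ?nz.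
  + by rewrite XRic !mx3E; mx3_ring; field; rewrite ?nz.
  (* Now x1 is the timelike vector of the plane; [d] and [q] are opposite to those of the metric
     (3), so the discriminant is the same. *)
  pose d := (2 * s ^+ 2 * t ^+ 2)^-1; pose q := (s ^+ 2 * t)^-1.
  have disc : d ^+ 2 - q ^+ 2 = (1 - 4 * t ^+ 2) / (2 * s ^+ 2 * t ^+ 2) ^+ 2.
    by rewrite /d /q; field; rewrite ?nz.
  pose S := mx3 [:: [:: 0; 0; 1]; [:: 0; t^-1; 0]; [:: s^-1; 0; 0]].
  have [] := frameX (frame X S) S
    (mx3 [:: [:: (1 - 4 * t ^+ 2) / (2 * s ^+ 2 * t ^+ 2); 0; 0];
             [:: 0; - (2 / s ^+ 2) + d; q];
             [:: 0; - q; - (2 / s ^+ 2) - d]]) erefl.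
  + by rewrite hM /M !mx3E; mx3_ring; field; rewrite ?nz.
  + by rewrite XRic !mx3E /d /q; mx3_ring; field; rewrite ?nz.
  move=> SO SRic YO YRic; split=> // sgn.
  + apply: (oneill_11_1_block RicL SO SRic).
    by rewrite disc divr_gt0 ?exprn_gt0.
  + apply: (oneill_1zz_block RicL SO SRic).
    by rewrite disc pmulr_llt0 ?invr_gt0 ?exprn_gt0.
  + apply: (oneill_21_block RicL SO SRic).
      by rewrite disc sgn mul0r.
    by rewrite invr_neq0 // gt_eqF.
- have XRic := g1_ricci_null br_alt XB br12 br31 br32 hL o0 ss0 hM.
  have [] := frameX Y
    (mx3 [:: [:: 0; r^-1; r^-1]; [:: 0; r^-1; - r^-1]; [:: s^-1; 0; 0]])
    (mx3 [:: [:: - (2 / s ^+ 2); 0; 0];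
             [:: 0; - (3 / s ^+ 2); 1 / s ^+ 2];
             [:: 0; - (1 / s ^+ 2); - (1 / s ^+ 2)]]).
  + by rewrite /Y; frame_eq.
  + by rewrite hM /M !mx3E; mx3_ring; field: r2; rewrite ?nz.
  + by rewrite XRic !mx3E; mx3_ring; field; rewrite ?nz.
  move=> YO YRic; split=> //.
  (* The block has diagonal -3 / mu, -1 / mu and q = 1 / mu, so d = - q and the discriminant
     vanishes for every mu. *)
  apply: (@oneill_21_block _ _ h _ RicL (- (2 / s ^+ 2)) (- (2 / s ^+ 2))
    (- (s ^+ 2)^-1) (s ^+ 2)^-1 Y YO).
  + by rewrite YRic; mx3_ring; field; rewrite ?nz.
  + by ring.
  + by rewrite oppr_eq0 invr_neq0.
- have XRic := g1_ricci_null br_alt XB br12 br31 br32 hL no0 ss0 hM.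
  have [] := frameX Y
    (mx3 [:: [:: 0; r^-1; r^-1]; [:: 0; - r^-1; r^-1]; [:: s^-1; 0; 0]])
    (mx3 [:: [:: - (2 / s ^+ 2); 0; 0];
             [:: 0; - (1 / s ^+ 2); - (1 / s ^+ 2)];
             [:: 0; 1 / s ^+ 2; - (3 / s ^+ 2)]]).
  + by rewrite /Y; frame_eq.
  + by rewrite hM /M !mx3E; mx3_ring; field: r2; rewrite ?nz.
  + by rewrite XRic !mx3E; mx3_ring; field; rewrite ?nz.
  move=> YO YRic; split=> //.
  (* The signs of [d] and [q] are both reversed, since y2 and y3 have exchanged directions. *)
  apply: (@oneill_21_block _ _ h _ RicL (- (2 / s ^+ 2)) (- (2 / s ^+ 2))
    (s ^+ 2)^-1 (- (s ^+ 2)^-1) Y YO).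
  + by rewrite YRic; mx3_ring; field; rewrite ?nz.
  + by ring.
  + by rewrite invr_neq0.
Qed.
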